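(* Let $\mathcal{D}$ be a triangulated category and $(\mathcal{D}^{\leq 0},\mathcal{D}^{\geq 1})$ a $t$-structure on $\mathcal{D}$ with heart $\mathcal{H}$. Let $\mathcal{U}$ be a homology-determined aisle in $\mathcal{D}$. Then $H^k\mathcal{U}$ is contravariantly finite in $\mathcal{H}$ for every $k\in\mathbb{Z}$.
   Context: All subcategories are full, additive and closed under isomorphisms. For the fixed $t$-structure put $\mathcal{D}^{\geq n+1}=\mathcal{D}^{\geq 1}[-n]$; the heart is $\mathcal{H}=\mathcal{D}^{\leq 0}\cap\mathcal{D}^{\geq 0}$, $H^0\colon\mathcal{D}\to\mathcal{H}$ is the associated cohomological functor, and $H^kX=H^0(X[k])$. For a subcategory $\mathcal{U}$, $H^k\mathcal{U}$ is the subcategory of $\mathcal{H}$ of objects isomorphic to $H^kX$ with $X\in\mathcal{U}$. A subcategory $\mathcal{U}$ of $\mathcal{D}$ is an aisle if it is the first component of some $t$-structure $(\mathcal{U},\mathcal{V})$ on $\mathcal{D}$, and it is homology-determined (with respect to the fixed $t$-structure) if for every $X\in\mathcal{D}$: $X\in\mathcal{U}$ if and only if $H^kX\in\mathcal{U}[k]$ for all $k\in\mathbb{Z}$. A subcategory $\mathcal{B}$ of $\mathcal{C}$ is contravariantly finite in $\mathcal{C}$ if for every $X\in\mathcal{C}$ there is a morphism $f\colon B\to X$ with $B\in\mathcal{B}$ through which every morphism $B'\to X$ with $B'\in\mathcal{B}$ factors. *)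

(* Defs.v *)
From mathcomp Require Import all_boot all_order all_algebra.
From mathcomp Require Import boolp classical_sets.

Set Implicit Arguments.
Unset Strict Implicit.
Unset Printing Implicit Defensive.

Import GRing.Theory.
Local Open Scope ring_scope.
Local Open Scope classical_set_scope.

(* Additive categories. Hom-sets are abelian groups, so that bilinearity of
   the composition is stated with the operations of zmodType. *)

Reserved Notation "g \oc f" (at level 40, left associativity).

Record preadditive := Preadditive {
  obj :> Type;
  hom : obj -> obj -> zmodType;
  idm : forall X, hom X X;
  comp : forall X Y Z, hom Y Z -> hom X Y -> hom X Z
    where "g \oc f" := (comp g f);
  comp1m : forall X Y (f : hom X Y), idm Y \oc f = f;
  compm1 : forall X Y (f : hom X Y), f \oc idm X = f;
  compA : forall W X Y Z (h : hom Y Z) (g : hom X Y) (f : hom W X),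
    h \oc (g \oc f) = h \oc g \oc f;
  compDl : forall X Y Z (g g' : hom Y Z) (f : hom X Y),
    (g + g') \oc f = g \oc f + g' \oc f;
  compDr : forall X Y Z (g : hom Y Z) (f f' : hom X Y),
    g \oc (f + f') = g \oc f + g \oc f' }.

Arguments hom {p} X Y.
Arguments idm {p} X.
Notation "g \oc f" := (comp g f) : ring_scope.

Section Preadditive.
Variable C : preadditive.
Implicit Types X Y S : C.

Definition is_iso X Y (f : hom X Y) : Prop :=
  exists g : hom Y X, g \oc f = idm X /\ f \oc g = idm Y.

Definition isomorphic X Y : Prop := exists f : hom X Y, is_iso f.

Definition is_zero X : Prop :=
  forall Y, (forall f : hom X Y, f = 0) /\ (forall f : hom Y X, f = 0).

Definition is_biproduct X Y S : Prop :=
  exists (i1 : hom X S) (i2 : hom Y S) (p1 : hom S X) (p2 : hom S Y),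
    [/\ p1 \oc i1 = idm X, p2 \oc i2 = idm Y, p1 \oc i2 = 0, p2 \oc i1 = 0
      & i1 \oc p1 + i2 \oc p2 = idm S].

(* A full subcategory is given by its set of objects. *)
Record additive_subcategory (P : set C) : Prop := AdditiveSubcategory {
  subcat_iso : forall X Y, isomorphic X Y -> P X -> P Y;
  subcat_zero : exists2 X, is_zero X & P X;
  subcat_biproduct : forall X Y S, is_biproduct X Y S -> P X -> P Y -> P S }.

Definition contravariantly_finite (B A : set C) : Prop :=
  forall X, A X -> exists (B0 : C) (f : hom B0 X),
    B B0 /\ forall B1 (g : hom B1 X), B B1 -> exists h : hom B1 B0, g = f \oc h.

End Preadditive.

Record additive := Additive {
  additive_cat :> preadditive;
  ex_zero : exists X : additive_cat, is_zero X;
  ex_biproduct : forall X Y : additive_cat, exists S, is_biproduct X Y S }.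

Record additive_endofunctor (C : preadditive) := AdditiveEndofunctor {
  fobj :> C -> C;
  fmap : forall X Y : C, hom X Y -> hom (fobj X) (fobj Y);
  fmap1 : forall X, fmap (idm X) = idm (fobj X);
  fmapM : forall X Y Z (g : hom Y Z) (f : hom X Y),
    fmap (g \oc f) = fmap g \oc fmap f;
  fmapD : forall X Y (f f' : hom X Y), fmap (f + f') = fmap f + fmap f' }.

(* The suspension [T] is an autoequivalence with a chosen quasi-inverse [T'];
   it is not required to be a strict automorphism. *)
Record autoequivalence (C : preadditive) := Autoequivalence {
  susp : additive_endofunctor C;
  desusp : additive_endofunctor C;
  unit_nt : forall X : C, hom X (desusp (susp X));
  unit_iso : forall X, is_iso (unit_nt X);
  unit_nat : forall X Y (f : hom X Y),
    fmap desusp (fmap susp f) \oc unit_nt X = unit_nt Y \oc f;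
  counit_nt : forall X : C, hom (susp (desusp X)) X;
  counit_iso : forall X, is_iso (counit_nt X);
  counit_nat : forall X Y (f : hom X Y),
    f \oc counit_nt X = counit_nt Y \oc fmap susp (fmap desusp f) }.

(* Verdier's axioms (TR1)-(TR4). *)
Record triangulated := Triangulated {
  triang_cat :> additive;
  sh : autoequivalence triang_cat;
  T := susp sh;
  dist : forall X Y Z : triang_cat,
    hom X Y -> hom Y Z -> hom Z (T X) -> Prop;
  TR1_iso : forall X Y Z X' Y' Z'
      (u : hom X Y) (v : hom Y Z) (w : hom Z (T X))
      (u' : hom X' Y') (v' : hom Y' Z') (w' : hom Z' (T X'))
      (a : hom X X') (b : hom Y Y') (c : hom Z Z'),
    is_iso a -> is_iso b -> is_iso c ->
    b \oc u = u' \oc a -> c \oc v = v' \oc b -> fmap T a \oc w = w' \oc c ->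
    dist u v w -> dist u' v' w';
  TR1_id : forall X Z, is_zero Z -> dist (idm X) (0 : hom X Z) 0;
  TR1_cone : forall X Y (u : hom X Y),
    exists Z (v : hom Y Z) (w : hom Z (T X)), dist u v w;
  TR2 : forall X Y Z (u : hom X Y) (v : hom Y Z) (w : hom Z (T X)),
    dist u v w <-> dist v w (- fmap T u);
  TR3 : forall X Y Z X' Y' Z'
      (u : hom X Y) (v : hom Y Z) (w : hom Z (T X))
      (u' : hom X' Y') (v' : hom Y' Z') (w' : hom Z' (T X'))
      (a : hom X X') (b : hom Y Y'),
    dist u v w -> dist u' v' w' -> b \oc u = u' \oc a ->
    exists c : hom Z Z', c \oc v = v' \oc b /\ fmap T a \oc w = w' \oc c;
  TR4 : forall X Y Z X' Y' Z'
      (u : hom X Y) (j : hom Y Z') (k : hom Z' (T X))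
      (v : hom Y Z) (l : hom Z X') (i : hom X' (T Y))
      (m : hom Z Y') (n : hom Y' (T X)),
    dist u j k -> dist v l i -> dist (v \oc u) m n ->
    exists (f : hom Z' Y') (g : hom Y' X'),
      [/\ dist f g (fmap T j \oc i), f \oc j = m \oc v, n \oc f = k,
          g \oc m = l & i \oc g = fmap T u \oc n] }.

Section Triangulated.
Variable D : triangulated.
Implicit Types (X Y : D) (U V : set D).

Definition shift X (k : int) : D :=
  match k with
  | Posz n => iter n (susp (sh D)) X
  | Negz n => iter n.+1 (desusp (sh D)) X
  end.

Definition subshift U (k : int) : set D :=
  [set Y | exists2 X, U X & isomorphic Y (shift X k)].

Record trunc_triangle U V X := TruncTriangle {
  tr_le : D;
  tr_ge : D;
  tr_in : hom tr_le X;
  tr_out : hom X tr_ge;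
  tr_bd : hom tr_ge (shift tr_le 1);
  tr_leP : U tr_le;
  tr_geP : V tr_ge;
  tr_dist : dist tr_in tr_out tr_bd }.

Record is_tstructure U V : Prop := IsTstructure {
  tst_le_add : additive_subcategory U;
  tst_ge_add : additive_subcategory V;
  tst_orth : forall X Y (f : hom X Y), U X -> V Y -> f = 0;
  tst_le_shift : subshift U 1 `<=` U;
  tst_ge_shift : subshift V (-1) `<=` V;
  tst_trunc : forall X, inhabited (trunc_triangle U V X) }.

Record tstructure := Tstructure {
  le0 : set D;
  ge1 : set D;
  tstructureP : is_tstructure le0 ge1 }.

Definition is_aisle U : Prop := exists V, is_tstructure U V.

Variable t : tstructure.

(* [dge n.+1 = ge1[-n]], hence [dge 0 = ge1[1]]. *)
Definition dge (n : int) : set D := subshift (ge1 t) (1 - n).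

Definition heart : set D := le0 t `&` dge 0.

Definition trunc X : trunc_triangle (le0 t) (ge1 t) X :=
  inhabited_witness (tst_trunc (tstructureP t) X).

Definition tau_le0 X : D := tr_le (trunc X).
Definition tau_ge1 X : D := tr_ge (trunc X).
Definition tau_ge0 X : D := shift (tau_ge1 (shift X (-1))) 1.

(* [H^0 = tau_ge0 \o tau_le0] and [H^k X = H^0 (X[k])]; only the action on
   objects is needed. *)
Definition Hcoh (k : int) X : D := tau_ge0 (tau_le0 (shift X k)).

Definition H_sub (k : int) U : set D :=
  [set B | heart B /\ exists2 X, U X & isomorphic B (Hcoh k X)].

Definition homology_determined U : Prop :=
  forall X, U X <-> forall k : int, subshift U k (Hcoh k X).

End Triangulated.

(* Main.v *)
Require Import Defs.
From mathcomp Require Import all_boot all_order all_algebra.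
From mathcomp Require Import boolp classical_sets.

(** Two universal properties make [H^0] computable by hand. Write
    [iota : tau_le0 X -> X] and [pi : tau_le0 X -> H^0 X] for the truncation
    morphisms. A morphism from an object of [D^{<= 0}] to [X] lifts along
    [iota], and a morphism from [tau_le0 X] to an object of [D^{>= 0}] extends
    along [pi]. So a morphism [f : X -> M] to an object of the heart induces
    [f' : H^0 X -> M] with [f' pi = f iota], and every morphism from an object
    of the heart to [M] that factors through [f] also factors through [f']
    ([Hcoh_precover]). This replaces the action of [H^0] on morphisms.

    Now let [M] be in the heart, say [M = M'[k]], and let [u : A -> M'] be the
    truncation of [M'] for the aisle [U]. Every morphism from an object of [U]
    to [M'] factors through [u]. Let [B] be in [H^k U]. As [U] is
    homology-determined, [B] lies in [U[k]], so, the shift being full, every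
    morphism [B -> M] factors through [u[k] : A[k] -> M]. By the first paragraph
    it factors through the induced morphism [H^k A -> M], whose source belongs
    to [H^k U].

    The shift is only an autoequivalence, so [X[k][-k]] is merely isomorphic to
    [X]. Morphisms and objects are therefore moved along the shift by fullness,
    faithfulness and essential surjectivity, never by cancelling [k] against
    [-k]. The lifting properties come from the weak
    kernels and weak cokernels of a distinguished triangle. That [H^0 X] lies in
    the heart follows from the description of [D^{<= 0}] as the left orthogonal
    of [D^{>= 1}]. *)

Set Implicit Arguments.
Unset Strict Implicit.
Unset Printing Implicit Defensive.

Import GRing.Theory Defs.
Local Open Scope ring_scope.
Local Open Scope classical_set_scope.

(** * Preadditive categories and their endofunctors *)

Section Preadditive.
Variable C : preadditive.
Implicit Types (X Y Z : C) (F : additive_endofunctor C).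

Lemma comp0m X Y Z (f : hom X Y) : (0 : hom Y Z) \oc f = 0.
Proof. by apply: (addrI (0 \oc f)); rewrite -compDl !addr0. Qed.

Lemma compm0 X Y Z (g : hom Y Z) : g \oc (0 : hom X Y) = 0.
Proof. by apply: (addrI (g \oc 0)); rewrite -compDr !addr0. Qed.

Lemma compNm X Y Z (g : hom Y Z) (f : hom X Y) : (- g) \oc f = - (g \oc f).
Proof.
by apply: (addrI (g \oc f)); rewrite -compDl !subrr comp0m.
Qed.

Lemma compmN X Y Z (g : hom Y Z) (f : hom X Y) : g \oc (- f) = - (g \oc f).
Proof.
by apply: (addrI (g \oc f)); rewrite -compDr !subrr compm0.
Qed.

Lemma fmap0 F X Y : fmap F (0 : hom X Y) = 0.
Proof. by apply: (addrI (fmap F 0)); rewrite -fmapD !addr0. Qed.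

Lemma fmapN F X Y (f : hom X Y) : fmap F (- f) = - fmap F f.
Proof. by apply: (addrI (fmap F f)); rewrite -fmapD !subrr fmap0. Qed.

Lemma is_zero_idm X : idm X = 0 -> is_zero X.
Proof.
move=> X0 Y; split=> f.
  by rewrite -[f]compm1 X0 compm0.
by rewrite -[f]comp1m X0 comp0m.
Qed.

Lemma fmap_zero F X : is_zero X -> is_zero (F X).
Proof. by case/(_ X)=> X0 _; apply: is_zero_idm; rewrite -fmap1 (X0 (idm X)) fmap0. Qed.

Lemma isomorphic_refl X : isomorphic X X.
Proof. by exists (idm X), (idm X); rewrite comp1m. Qed.

Lemma isomorphic_sym X Y : isomorphic X Y -> isomorphic Y X.
Proof. by case=> f [g [gf fg]]; exists g, f. Qed.

Lemma isomorphic_trans X Y Z :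
  isomorphic X Y -> isomorphic Y Z -> isomorphic X Z.
Proof.
case=> f [f' [f'f ff']] [g [g' [g'g gg']]].
exists (g \oc f), (f' \oc g'); split.
  by rewrite compA -(compA f') g'g compm1.
by rewrite compA -(compA g) ff' compm1.
Qed.

Lemma fmap_isomorphic F X Y : isomorphic X Y -> isomorphic (F X) (F Y).
Proof.
case=> f [g [gf fg]]; exists (fmap F f), (fmap F g).
by rewrite -!fmapM gf fg !fmap1.
Qed.

Lemma iso_monic X Y Z (h : hom Y Z) (f g : hom X Y) :
  is_iso h -> h \oc f = h \oc g -> f = g.
Proof.
case=> h' [h'h _] /(congr1 (comp h')).
by rewrite !compA h'h !comp1m.
Qed.

Lemma iso_epic X Y Z (h : hom X Y) (f g : hom Y Z) :
  is_iso h -> f \oc h = g \oc h -> f = g.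
Proof.
case=> h' [_ hh'] /(congr1 (fun k => k \oc h')).
by rewrite -!compA hh' !compm1.
Qed.

Definition full F : Prop :=
  forall X Y (g : hom (F X) (F Y)), exists f, g = fmap F f.

Definition faithful F : Prop :=
  forall X Y (f g : hom X Y), fmap F f = fmap F g -> f = g.

Definition ess_surjective F : Prop := forall Y, exists X, isomorphic Y (F X).

Section Iterate.
Variable F : additive_endofunctor C.

Fixpoint iter_fmap n X Y (f : hom X Y) : hom (iter n F X) (iter n F Y) :=
  if n is m.+1 then fmap F (iter_fmap m f) else f.

Lemma iter_fmap1 n X : iter_fmap n (idm X) = idm _.
Proof. by elim: n => //= n ->; rewrite fmap1. Qed.

Lemma iter_fmapM n X Y Z (g : hom Y Z) (f : hom X Y) :
  iter_fmap n (g \oc f) = iter_fmap n g \oc iter_fmap n f.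
Proof. by elim: n => //= n ->; rewrite fmapM. Qed.

Lemma iter_fmapD n X Y (f g : hom X Y) :
  iter_fmap n (f + g) = iter_fmap n f + iter_fmap n g.
Proof. by elim: n => //= n ->; rewrite fmapD. Qed.

Definition iter_functor n : additive_endofunctor C :=
  {| fobj := iter n F; fmap := iter_fmap n; fmap1 := iter_fmap1 n;
     fmapM := @iter_fmapM n; fmapD := @iter_fmapD n |}.

Lemma iter_full n : full F -> full (iter_functor n).
Proof.
move=> fullF; elim: n => [|n IHn] X Y g; first by exists g.
by have [h ->] := fullF _ _ g; have [f ->] := IHn _ _ h; exists f.
Qed.

Lemma iter_ess_surjective n : ess_surjective F -> ess_surjective (iter_functor n).
Proof.
move=> surjF; elim: n => [|n IHn] Y; first by exists Y; apply: isomorphic_refl.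
have [Z YZ] := surjF Y; have [X ZX] := IHn Z; exists X.
exact: isomorphic_trans YZ (fmap_isomorphic F ZX).
Qed.

End Iterate.

End Preadditive.

Section Autoequivalence.
Variables (C : preadditive) (e : autoequivalence C).
Local Notation T := (susp e).
Local Notation T' := (desusp e).

Lemma susp_faithful : faithful T.
Proof.
move=> X Y f g fg; apply: (iso_monic (unit_iso e Y)).
by rewrite -!unit_nat fg.
Qed.

Lemma desusp_faithful : faithful T'.
Proof.
move=> X Y f g fg; apply: (iso_epic (counit_iso e X)).
by rewrite !counit_nat fg.
Qed.

(** The conjugate of [T' g] by the units is a preimage of [g]: both have the
    same image under the faithful functor [T']. *)
Lemma susp_full : full T.
Proof.
move=> X Y g; have [v [_ uv]] := unit_iso e Y.
exists (v \oc (fmap T' g \oc unit_nt e X)); apply: desusp_faithful.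
by apply: (iso_epic (unit_iso e X)); rewrite unit_nat compA uv comp1m.
Qed.

Lemma desusp_full : full T'.
Proof.
move=> X Y g; have [v [vc _]] := counit_iso e X.
exists (counit_nt e Y \oc fmap T g \oc v); apply: susp_faithful.
by apply: (iso_monic (counit_iso e Y)); rewrite -counit_nat -compA vc compm1.
Qed.

Lemma susp_ess_surjective : ess_surjective T.
Proof.
by move=> X; exists (T' X); apply: isomorphic_sym; eexists; apply: counit_iso.
Qed.

Lemma desusp_ess_surjective : ess_surjective T'.
Proof. by move=> X; exists (T X); eexists; apply: unit_iso. Qed.

End Autoequivalence.

(** * Triangulated categories *)

Section Triangulated.
Variable D : triangulated.
Implicit Types (X Y Z F : D) (U V : set D).
Local Notation T := (susp (sh D)).
Local Notation T' := (desusp (sh D)).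

Definition shift_fmap (k : int) X Y : hom X Y -> hom (shift X k) (shift Y k) :=
  match k with
  | Posz n => @iter_fmap _ T n X Y
  | Negz n => @iter_fmap _ T' n.+1 X Y
  end.

Lemma shift_fmapM k X Y Z (g : hom Y Z) (f : hom X Y) :
  shift_fmap k (g \oc f) = shift_fmap k g \oc shift_fmap k f.
Proof. by case: k => n; apply: iter_fmapM. Qed.

Lemma shift_full k X Y (g : hom (shift X k) (shift Y k)) :
  exists f : hom X Y, g = shift_fmap k f.
Proof.
case: k g => n g.
  exact: (iter_full (n := n) (@susp_full _ (sh D))).
exact: (iter_full (n := n.+1) (@desusp_full _ (sh D))).
Qed.

Lemma shift_ess_surjective k Y : exists X, isomorphic Y (shift X k).
Proof.
case: k => n.
  exact: (iter_ess_surjective n (@susp_ess_surjective _ (sh D))).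
exact: (iter_ess_surjective n.+1 (@desusp_ess_surjective _ (sh D))).
Qed.

(** Completing the square formed by [f] and [0] to a morphism into the
    triangle [0 -> F = F -> 0] produces the extension. *)
Lemma weak_cokernel X Y Z F (u : hom X Y) (v : hom Y Z) (w : hom Z (T X))
    (f : hom Y F) :
  dist u v w -> f \oc u = 0 -> exists g : hom Z F, f = g \oc v.
Proof.
move=> uvw fu0; have [O O0] := ex_zero D.
have OF : dist (0 : hom O F) (idm F) 0.
  apply/TR2; rewrite fmap0 oppr0; apply: TR1_id; exact: fmap_zero.
have [|g [gv _]] := TR3 (a := 0) (b := f) uvw OF; first by rewrite fu0 comp0m.
by exists g; rewrite gv comp1m.
Qed.

(** The third morphism of a map from the triangle [F -> 0 -> T F] to the
    rotation of the given one is, up to [T], the lift. *)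
Lemma weak_kernel X Y Z F (u : hom X Y) (v : hom Y Z) (w : hom Z (T X))
    (f : hom F Y) :
  dist u v w -> v \oc f = 0 -> exists g : hom F X, f = u \oc g.
Proof.
move=> uvw vf0; have [O O0] := ex_zero D.
have FO : dist (0 : hom F O) (0 : hom O (T F)) (- fmap T (idm F)).
  by apply: (TR2 _ _ _).1; apply: TR1_id.
have [|h [_ fh]] := TR3 (a := f) (b := 0) FO ((TR2 u v w).1 uvw).
  by rewrite vf0 comp0m.
have [g gE] := susp_full h; exists g; apply: (@susp_faithful _ (sh D)).
apply: oppr_inj; move: fh.
by rewrite gE compNm -fmapM compmN fmap1 compm1.
Qed.

Lemma dist_iso X Y Z (u : hom X Y) (v : hom Y Z) (w : hom Z (T X)) :
  dist u v w -> is_zero Z -> is_iso u.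
Proof.
move=> uvw Z0.
have [|s us] := weak_kernel (f := idm Y) uvw; first exact: (Z0 _).2.
exists s; split=> //.
apply: (@susp_faithful _ (sh D)); apply/eqP; rewrite -subr_eq0 -fmapN -fmapD.
(* The difference becomes zero after [u], so its shift factors through [Z]. *)
set d := s \oc u - idm X.
have ud0 : u \oc d = 0 by rewrite compDr compmN compA -us comp1m compm1 subrr.
have [|g ->] := weak_kernel (f := fmap T d) ((TR2 _ _ _).1 ((TR2 _ _ _).1 uvw)).
  by rewrite compNm -fmapM ud0 fmap0 oppr0.
by rewrite ((Z0 _).2 g) compm0.
Qed.

Lemma subcat_isomorphic U X Y :
  additive_subcategory U -> isomorphic X Y -> U Y -> U X.
Proof. by move=> addU /isomorphic_sym; apply: subcat_iso. Qed.

(** * t-structures *)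

Section Tstructure.
Variables U V : set D.
Hypothesis UV : is_tstructure U V.

Lemma aisle_shift X : U X -> U (T X).
Proof.
move=> UX; apply: (tst_le_shift UV); exists X => //.
exact: isomorphic_refl.
Qed.

Lemma aisle_lift X A (tr : trunc_triangle U V X) (f : hom A X) :
  U A -> exists g : hom A (tr_le tr), f = tr_in tr \oc g.
Proof.
move=> UA; apply: weak_kernel (tr_dist tr) _.
exact: (tst_orth UV) _ UA (tr_geP tr).
Qed.

Lemma coaisle_extend X B (tr : trunc_triangle U V X) (f : hom X B) :
  V B -> exists g : hom (tr_ge tr) B, f = g \oc tr_out tr.
Proof.
move=> VB; apply: weak_cokernel (tr_dist tr) _.
exact: (tst_orth UV) _ (tr_leP tr) VB.
Qed.

(** If [X] is left orthogonal to [V] then the truncation triangle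
    [A -> X -> B -> A[1]] has zero second morphism, so the identity of [B]
    factors through [A[1]], which belongs to [U]; hence [B] is zero and [X] is
    isomorphic to [A]. *)
Lemma left_orthogonal_aisle X :
  (forall B (f : hom X B), V B -> f = 0) -> U X.
Proof.
move=> orthX; have [tr] := tst_trunc UV X.
have v0 : tr_out tr = 0 by apply: orthX; apply: tr_geP.
have [|q qE] := weak_cokernel (f := idm (tr_ge tr)) ((TR2 _ _ _).1 (tr_dist tr)).
  by rewrite comp1m.
have q0 : q = 0.
  exact: (tst_orth UV) _ (aisle_shift (tr_leP tr)) (tr_geP tr).
have B0 : is_zero (tr_ge tr) by apply: is_zero_idm; rewrite qE q0 comp0m.
apply: (subcat_iso (tst_le_add UV)) _ (tr_leP tr).
by exists (tr_in tr); apply: dist_iso (tr_dist tr) B0.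
Qed.

End Tstructure.

(** * The cohomological functor of a t-structure *)

Section Cohomology.
Variable t : tstructure D.

Lemma dge0E M : dge t 0 M <-> exists2 N, ge1 t N & isomorphic M (T N).
Proof. by rewrite /dge subr0. Qed.

(** Since [tau_ge0 Y] is defined as [T (tau_ge1 (T' Y))], the factorization is
    carried out after transporting [Y -> M] to a morphism out of [T' Y]. *)
Lemma tau_ge0_extend Y : exists p : hom Y (tau_ge0 t Y),
  forall M (f : hom Y M), dge t 0 M -> exists g, f = g \oc p.
Proof.
have [c' [_ cc']] := counit_iso (sh D) Y.
set v := tr_out (trunc t (T' Y)).
exists (fmap T v \oc c') => M f /dge0E[N geN [i [j [ji ij]]]].
have [h hE] := susp_full (i \oc f \oc counit_nt (sh D) Y).
have [g gE] := coaisle_extend (tstructureP t) (trunc t (T' Y)) h geN.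
exists (j \oc fmap T g).
rewrite -compA [fmap T g \oc _]compA -fmapM -gE -hE.
by rewrite -compA cc' compm1 compA ji comp1m.
Qed.

Lemma tau_ge0_dge Y : dge t 0 (tau_ge0 t Y).
Proof.
apply/dge0E; exists (tau_ge1 t (T' Y)); first exact: tr_geP.
exact: isomorphic_refl.
Qed.

(** The shifted truncation triangle [T A -> T (T' Y) -> tau_ge0 Y -> T (T A)]
    exhibits [tau_ge0 Y] as an extension of objects that are left orthogonal to
    [D^{>= 1}]. *)
Lemma tau_ge0_le0 Y : le0 t Y -> le0 t (tau_ge0 t Y).
Proof.
have tP := tstructureP t.
move=> leY; apply: (left_orthogonal_aisle tP) => B f geB.
set tr := trunc t (T' Y).
have leTT' : le0 t (T (T' Y)).
  apply: subcat_isomorphic (tst_le_add tP) _ leY.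
  by exists (counit_nt _ Y); apply: counit_iso.
have d : dist (- fmap T (tr_in tr)) (- fmap T (tr_out tr)) (- fmap T (tr_bd tr)).
  by do 3! apply: (TR2 _ _ _).1; apply: tr_dist.
have [|g ->] := weak_cokernel (f := f) ((TR2 _ _ _).1 d).
  exact: (tst_orth tP) _ leTT' geB.
have g0 : g = 0.
  apply: (tst_orth tP) _ _ geB; do 2! apply: (aisle_shift tP).
  exact: tr_leP.
by rewrite g0 comp0m.
Qed.

Lemma Hcoh_heart k X : heart t (Hcoh t k X).
Proof. by split; [apply: tau_ge0_le0; apply: tr_leP | apply: tau_ge0_dge]. Qed.

(** Stands in for the action of [H^k] on [f]: a morphism [g] from the heart
    that factors through [f] lifts to [tau_le0], and the projection of the lift
    to [H^k X] gives the factorization through [f']. *)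
Lemma Hcoh_precover k X M (f : hom (shift X k) M) : heart t M ->
  exists f' : hom (Hcoh t k X) M, forall B (h : hom B (shift X k)),
    heart t B -> exists h', f \oc h = f' \oc h'.
Proof.
case=> _ geM; set tr := trunc t (shift X k).
have [p pP] := tau_ge0_extend (tr_le tr).
have [f' f'E] := pP _ (f \oc tr_in tr) geM.
exists f' => B h [leB _].
have [h1 ->] := aisle_lift (tstructureP t) tr h leB.
by exists (p \oc h1); rewrite !compA -f'E.
Qed.

Lemma H_sub_subshift U k B :
  homology_determined t U -> H_sub t k U B -> subshift U k B.
Proof.
move=> hUt [_ [X UX BX]]; have [Y UY XY] := (hUt X).1 UX k.
by exists Y => //; apply: isomorphic_trans BX XY.
Qed.

End Cohomology.

(** Since the shift by [k] is full, it carries the lifting property of the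
    truncation of [M'] for [U] to the subcategory [U[k]], where [M'] is an object
    with [M'[k]] isomorphic to [M]. *)
Lemma aisle_shift_precover U k M : is_aisle U ->
  exists2 A, U A & exists f : hom (shift A k) M,
    forall B (g : hom B M), subshift U k B -> exists h, g = f \oc h.
Proof.
case=> V UV; have [M' [i [j [ji ij]]]] := shift_ess_surjective k M.
have [tr] := tst_trunc UV M'.
exists (tr_le tr); first exact: tr_leP.
exists (j \oc shift_fmap k (tr_in tr)) => B g [X UX [a [b [ba ab]]]].
have [g' g'E] := shift_full (i \oc g \oc b).
have [h hE] := aisle_lift UV tr g' UX.
exists (shift_fmap k h \oc a).
rewrite -compA [shift_fmap k (tr_in tr) \oc _]compA -shift_fmapM -hE -g'E.
by rewrite -compA ba compm1 compA ji comp1m.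
Qed.

End Triangulated.

Theorem proposition5p1 (D : triangulated) (t : tstructure D) (U : set D)
    (hU : is_aisle U) (hUt : homology_determined t U) (k : int) :
  contravariantly_finite (H_sub t k U) (heart t).
Proof.
move=> M heartM.
have [A UA [f fP]] := aisle_shift_precover k M hU.
have [f' f'P] := Hcoh_precover f heartM.
exists (Hcoh t k A), f'; split.
  split; first exact: Hcoh_heart.
  by exists A => //; apply: isomorphic_refl.
move=> B g HB; have [h ->] := fP _ g (H_sub_subshift hUt HB).
by apply: f'P; case: HB.
Qed.
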